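(* Let $f:\mathbb{N}\to\mathbb{N}$ be an unbounded nondecreasing function. Then there exists an elementary amenable lawless group $\Gamma$, generated by a finite set $S$, such that $\mathcal{A}_{\Gamma}^{S}\succeq f$.
   Context: $\mathbb{N}=\{1,2,3,\dots\}$. For a group $\Gamma$ and the free group $F_k$ of rank $k$, a nontrivial $w\in F_k$ is a law for $\Gamma$ if $w(g_1,\dots,g_k)=e$ for all $g_1,\dots,g_k\in\Gamma$. $\Gamma$ is lawless if for some $k\ge 2$ (equivalently for all $k\ge1$) it has no law in $F_k$. Let $S$ be a generating set of $\Gamma$, $|\cdot|_S$ the word length on $\Gamma$, and $|\cdot|$ the word length on $F_k$ with respect to a fixed free basis. For a nontrivial $w\in F_k$ that is not a law for $\Gamma$, put $\chi_\Gamma^S(w)=\min\{\sum_{i=1}^k|g_i|_S : g_i\in\Gamma,\ w(g_1,\dots,g_k)\ne e\}$. For $\Gamma$ lawless and a fixed $k\ge 2$, the lawlessness growth is $\mathcal{A}_\Gamma^S(l)=\max\{\chi_\Gamma^S(w): w\in F_k\setminus\{1\},\ |w|\le l\}$ for $l\in\mathbb{N}$; up to the equivalence $\approx$ below it does not depend on the choice of $k\ge2$. For nondecreasing $F_1,F_2:\mathbb{N}\to\mathbb{N}$ write $F_1\preceq F_2$ (equivalently $F_2\succeq F_1$) if there is $K\in\mathbb{N}$ with $F_1(l)\le K F_2(Kl)$ for all $l\in\mathbb{N}$, and $F_1\approx F_2$ if $F_1\preceq F_2$ and $F_2\preceq F_1$. The class of elementary amenable groups is the smallest class containing all finite groups and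 $\mathbb{Z}$ and closed under subgroups, quotients, extensions and directed limits. *)

(* Defs.v *)
From HB Require Import structures.
From mathcomp Require Import all_boot all_order ssralg ssrint.
From mathcomp Require Import boolp classical_sets cardinality.

Set Implicit Arguments.
Unset Strict Implicit.
Unset Printing Implicit Defensive.

Local Open Scope classical_set_scope.

(* [N] is {1, 2, ...} below: functions on it are functions on [nat] of which
   only the values at positive arguments matter. *)

Definition preceq (F1 F2 : nat -> nat) : Prop :=
  exists2 K : nat, 0 < K & forall l : nat, 0 < l -> F1 l <= K * F2 (K * l).

(* Total minimum and maximum of a set of naturals; the value is the junk 0
   when there is no minimum (resp. maximum). *)
Definition nat_min (A : set nat) : nat :=
  xget 0 [set n | A n /\ forall m, A m -> n <= m].

Definition nat_max (A : set nat) : nat :=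
  xget 0 [set n | A n /\ forall m, A m -> m <= n].

(* The free group of rank k, as the group of reduced words: [(i, false)] is
   the i-th basis element and [(i, true)] is its inverse. *)
Section FreeGroup.
Variable k : nat.

Definition letter : Type := ('I_k * bool)%type.
Implicit Types (a b : letter) (u v w : seq letter).

Definition linv a : letter := (a.1, ~~ a.2).

Definition reduced w : bool := sorted (fun a b => b != linv a) w.

Definition push a w : seq letter :=
  if w is b :: w' then if b == linv a then w' else a :: w else [:: a].

Definition reduce w : seq letter := foldr push [::] w.

Record free_group := FreeWord { fword :> seq letter; _ : reduced fword }.

HB.instance Definition _ := [isSub for fword].
HB.instance Definition _ := [Choice of free_group by <:].

Lemma linvK : involutive linv.
Proof. by case=> i b; rewrite /linv /= negbK. Qed.

Lemma reduced_push a w : reduced w -> reduced (push a w).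
Proof.
case: w => //= b w redw; case: ifP => [_|/negbT nba /=]; last by rewrite nba.
exact: path_sorted redw.
Qed.

Lemma reduced_foldr u w : reduced w -> reduced (foldr push w u).
Proof. by move=> redw; elim: u => //= a u; apply: reduced_push. Qed.

Lemma push_linv a w : reduced w -> push (linv a) (push a w) = w.
Proof.
case: w => [|b w] /=; first by rewrite linvK eqxx.
move=> redw; case: ifP => [/eqP eb|_] /=; last by rewrite linvK eqxx.
case: w redw => [|c w] /=; rewrite -eb //.
by case/andP=> /negPf -> _.
Qed.

Lemma foldr_push a u w : reduced w ->
  foldr push w (push a u) = push a (foldr push w u).
Proof.
move=> redw; case: u => //= b u; case: ifP => //= /eqP ->.
by rewrite -{1}(linvK a) push_linv //; apply: reduced_foldr.
Qed.

Lemma foldr_reduce u w : reduced w -> foldr push w (reduce u) = foldr push w u.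
Proof. by move=> redw; elim: u => //= a u IHu; rewrite foldr_push ?IHu. Qed.

Lemma reduced_reduce w : reduced (reduce w).
Proof. exact: reduced_foldr. Qed.

Lemma reduceK w : reduced w -> reduce w = w.
Proof.
elim: w => //= a w IHw redw; rewrite IHw; last exact: path_sorted redw.
by case: w redw {IHw} => //= b w /andP[/negPf-> _].
Qed.

Lemma foldr_linv u w : reduced w ->
  foldr push (foldr push w u) (rev (map linv u)) = w.
Proof.
move=> redw; elim: u => //= a u IHu.
by rewrite rev_cons foldr_rcons push_linv ?IHu //; apply: reduced_foldr.
Qed.

Definition free_one : free_group := @FreeWord [::] isT.

Definition free_mul (u v : free_group) : free_group :=
  FreeWord (reduced_reduce (u ++ v)).

Definition free_inv (u : free_group) : free_group :=
  FreeWord (reduced_reduce (rev (map linv u))).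

Fact free_mulA : associative free_mul.
Proof.
move=> u v w; apply: val_inj => /=.
rewrite {1}/reduce foldr_cat [X in foldr _ X _](reduceK (reduced_reduce _)).
rewrite [in RHS]/reduce foldr_cat foldr_reduce; last exact: reduced_reduce.
by rewrite /reduce !foldr_cat.
Qed.

Fact free_mul1g : left_id free_one free_mul.
Proof. by move=> [u redu]; apply: val_inj; apply: reduceK. Qed.

Fact free_mulg1 : right_id free_one free_mul.
Proof. by move=> [u redu]; apply: val_inj; rewrite /= cats0; apply: reduceK. Qed.

Fact free_mulVg : left_inverse free_one free_inv free_mul.
Proof.
move=> u; apply: val_inj; rewrite /= {1}/reduce foldr_cat.
by rewrite foldr_reduce ?foldr_linv //; apply: reduced_foldr.
Qed.

Fact free_mulgV : right_inverse free_one free_inv free_mul.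
Proof.
move=> u; apply: val_inj; rewrite /= {1}/reduce foldr_cat.
rewrite -[foldr _ _ (reduce _)]/(reduce _) (reduceK (reduced_reduce _)).
have := @foldr_linv (rev (map linv u)) [::] isT.
by rewrite map_rev revK (mapK linvK).
Qed.

HB.instance Definition _ := isGroup.Build free_group
  free_mulA free_mul1g free_mulg1 free_mulVg free_mulgV.

Definition flength (w : free_group) : nat := size w.

End FreeGroup.

Definition eval_letter (k : nat) (G : groupType) (g : 'I_k -> G)
  (a : letter k) : G := (if a.2 then (g a.1)^-1 else g a.1)%g.

Definition eval (k : nat) (G : groupType) (g : 'I_k -> G) (w : free_group k) : G :=
  (\prod_(a <- fword w) eval_letter g a)%g.

Section Eval.
Variables (k : nat) (G : groupType) (g : 'I_k -> G).

Lemma eval_reduce (w : seq (letter k)) :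
  (\prod_(a <- reduce w) eval_letter g a
    = \prod_(a <- w) eval_letter g a)%g.
Proof.
elim: w => //= a w IHw; rewrite big_cons -IHw.
case: (reduce w) => [|b u] /=; first by rewrite !big_cons.
case: ifP => [/eqP->|_]; last by rewrite big_cons.
rewrite big_cons mulgA [X in (X * _)%g](_ : _ = 1%g) ?mul1g //.
by case: a => i [] /=; rewrite /eval_letter /= ?mulVg ?mulgV.
Qed.

Lemma evalM : {morph eval g : u v / (u * v)%g}.
Proof. by move=> u v; rewrite /eval eval_reduce big_cat. Qed.

HB.instance Definition _ :=
  isMultiplicative.Build (free_group k) G (eval g) evalM.

End Eval.

Definition is_law (G : groupType) (k : nat) (w : free_group k) : Prop :=
  w <> 1%g /\ forall g : 'I_k -> G, eval g w = 1%g.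

Definition lawless (G : groupType) : Prop :=
  exists2 k : nat, 2 <= k & forall w : free_group k, ~ is_law G w.

Definition is_word (G : groupType) (S : set G) (s : seq G) : Prop :=
  forall x, x \in s -> S x \/ S x^-1%g.

Definition generates (G : groupType) (S : set G) : Prop :=
  forall x : G, exists2 s : seq G, is_word S s & (\prod_(y <- s) y)%g = x.

Definition word_length (G : groupType) (S : set G) (x : G) : nat :=
  nat_min [set size s | s in [set s | is_word S s /\ (\prod_(y <- s) y)%g = x]].

Definition lawlessness_complexity (G : groupType) (S : set G) (k : nat)
    (w : free_group k) : nat :=
  nat_min [set \sum_(i < k) word_length S (g i) |
           g in [set g : 'I_k -> G | eval g w <> 1%g]].

Definition lawlessness_growth (G : groupType) (S : set G) (k l : nat) : nat :=
  nat_max [set lawlessness_complexity S w |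
           w in [set w : free_group k | w <> 1%g /\ flength w <= l]].

(* The infinite cyclic group: the additive group of the integers, as a
   (multiplicatively written) [groupType]. *)
Definition int_group : Type := int.
HB.instance Definition _ := Choice.on int_group.
HB.instance Definition _ := isGroup.Build int_group
  (@GRing.addrA int) (@GRing.add0r int) (@GRing.addr0 int)
  (@GRing.addNr int) (@GRing.addrN int).

Record directed_system := DirectedSystem {
  ds_index : Type;
  ds_le : ds_index -> ds_index -> Prop;
  ds_inhabited : inhabited ds_index;
  ds_refl : forall i, ds_le i i;
  ds_trans : forall j i l, ds_le i j -> ds_le j l -> ds_le i l;
  ds_directed : forall i j, exists2 l, ds_le i l & ds_le j l;
  ds_group : ds_index -> groupType;
  ds_map : forall i j, ds_le i j -> {multiplicative ds_group i -> ds_group j};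
  ds_map_id : forall i (ii : ds_le i i) x, ds_map ii x = x;
  ds_map_comp : forall i j l (ij : ds_le i j) (jl : ds_le j l) (il : ds_le i l) x,
    ds_map jl (ds_map ij x) = ds_map il x }.
Arguments ds_group : clear implicits.

Definition cocone (D : directed_system) (L : groupType)
    (phi : forall i, {multiplicative ds_group D i -> L}) : Prop :=
  forall i j (ij : ds_le i j) x, phi j (ds_map ij x) = phi i x.

Definition is_directed_limit (D : directed_system) (L : groupType)
    (phi : forall i, {multiplicative ds_group D i -> L}) : Prop :=
  cocone phi /\
  forall (H : groupType) (psi : forall i, {multiplicative ds_group D i -> H}),
    cocone psi ->
    exists u : {multiplicative L -> H},
      (forall i x, u (phi i x) = psi i x) /\
      (forall v : {multiplicative L -> H},
         (forall i x, v (phi i x) = psi i x) -> v =1 u).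

(* Subgroups and quotients are taken up to isomorphism, as (domains of)
   injective and (codomains of) surjective homomorphisms. *)
Inductive elementary_amenable : groupType -> Prop :=
| EA_finite (G : groupType) :
    finite_set [set: G] -> elementary_amenable G
| EA_int : elementary_amenable int_group
| EA_subgroup (G H : groupType) (i : {multiplicative H -> G}) :
    injective i -> elementary_amenable G -> elementary_amenable H
| EA_quotient (G Q : groupType) (p : {multiplicative G -> Q}) :
    (forall y, exists x, p x = y) ->
    elementary_amenable G -> elementary_amenable Q
| EA_extension (N G Q : groupType)
    (i : {multiplicative N -> G}) (p : {multiplicative G -> Q}) :
    injective i -> (forall y, exists x, p x = y) ->
    (forall x, p x = 1%g <-> exists n, i n = x) ->
    elementary_amenable N -> elementary_amenable Q -> elementary_amenable G
| EA_directed_limit (D : directed_system) (L : groupType)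
    (phi : forall i, {multiplicative ds_group D i -> L}) :
    is_directed_limit phi ->
    (forall i, elementary_amenable (ds_group D i)) -> elementary_amenable L.

(* Main.v *)
Require Import Defs.
From HB Require Import structures.
From mathcomp Require Import all_boot all_fingroup cyclic ssralg ssrint zify.
From mathcomp Require Import boolp classical_sets cardinality.

(* Gamma is a lamplighter-like group with infinitely many kinds of lamps: over
   each integer and each n sits a lamp with states in a finite group H n. It is
   generated by the walk t, by a toggle multiplying lamp n at 0 by a_n, and by
   a toggle multiplying lamp n at p n by b_n, for all n at once. Every
   nontrivial word in two letters is violated by some pair (a_n, b_n), hence by
   the first toggle and the conjugate of the second one by t^(p n).
   An element of length at most r moves a_n and b_n past each other only if
   p n <= 2 r; for the other n, lamp n is determined by the net numbers of
   toggles at each position, which vanish on double commutators. So, if E N is a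
   multiple of the orders of H 0, ..., H (N - 1), the E N-th power of a double
   commutator can be nontrivial only on elements of length of order
   p N / E N. As the p n are free, this can be made larger than f (E (N + 1)),
   which dominates f l for E N <= l < E (N + 1).
   Gamma is elementary amenable because its elements with trivial walk and net
   toggle numbers, which are integers, light only finitely many lamps. *)

Set Implicit Arguments.
Unset Strict Implicit.
Unset Printing Implicit Defensive.

Import GRing.Theory.
Local Open Scope classical_set_scope.

(** * Short words and finite quotients of free groups *)

Lemma nat_minP (A : set nat) : A !=set0 ->
  A (nat_min A) /\ forall m, A m -> nat_min A <= m.
Proof.
move=> [n An]; rewrite /nat_min.
apply: (@xgetPex _ 0 [set n | A n /\ forall m, A m -> n <= m]).
have exA : exists n, `[< A n >] by exists n; apply/asboolP.
case: (ex_minnP exA) => m /asboolP Am m_min.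
by exists m; split=> // j Aj; apply: m_min; apply/asboolP.
Qed.

Lemma leq_nat_max (A : set nat) (M n : nat) :
  (forall m, A m -> m <= M) -> A n -> n <= nat_max A.
Proof.
move=> ubM An; have exA : exists n, `[< A n >] by exists n; apply/asboolP.
have ubA m : `[< A m >] -> m <= M by move/asboolP/ubM.
have [|_] := @xgetPex _ 0 [set n | A n /\ forall m, A m -> m <= n].
  case: (ex_maxnP exA ubA) => m /asboolP Am m_max.
  by exists m; split=> // j Aj; apply: m_max; apply/asboolP.
exact.
Qed.

(** Induction on the length, summing over the finitely many first letters. The bound makes the
    maximum in [lawlessness_growth] a genuine one and not the default 0. *)
Lemma bounded_short_words (T : finType) (F : seq T -> nat) (l : nat) :
  exists M, forall s, size s <= l -> F s <= M.
Proof.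
elim: l F => [|l IHl] F; first by exists (F [::]) => -[].
have /choice[M leM] : forall a, exists M,
    forall s, size s <= l -> F (a :: s) <= M.
  by move=> a; apply: IHl.
exists (F [::] + \sum_a M a) => -[|a s] /= => [_|le_s]; first exact: leq_addr.
by rewrite (bigD1 a) //= addnCA (leq_trans (leM a s le_s)) ?leq_addr.
Qed.

Lemma word_lengthP (G : groupType) (S : set G) (x : G) : generates S ->
  exists s, [/\ is_word S s, (\prod_(y <- s) y)%g = x & size s = word_length S x].
Proof.
move=> genS; have [s Ss sx] := genS x.
rewrite /word_length; set A := (X in nat_min X).
have [|[r [Sr rx] <-] _] := @nat_minP A; first by exists (size s), s.
by exists r.
Qed.

Section GrowthBound.
Variables (G : groupType) (S : set G) (k : nat).

Lemma leq_lawlessness_growth (w : free_group k) (l : nat) :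
  w <> 1%g -> flength w <= l ->
  lawlessness_complexity S w <= lawlessness_growth S k l.
Proof.
(* [F] extends the complexity by 0 to words that are not reduced. *)
move=> w1 wl; pose F s :=
  oapp (@lawlessness_complexity _ S k) 0 (insub s : option (free_group k)).
have [M leM] := bounded_short_words F l.
apply: (@leq_nat_max _ M) => [_ [v [_ vl] <-]|]; last by exists w.
by have := leM (fword v) vl; rewrite /F /= valK.
Qed.

End GrowthBound.

Section PartialInjection.
Variables (T : finType) (R : rel T).
Hypotheses (R_fun : forall x y z, R x y -> R x z -> y = z)
  (R_inj : forall x y z, R x z -> R y z -> x = y).

Lemma perm_extension : exists s : {perm T}, forall x y, R x y -> s x = y.
Proof.
suff [s sR] : exists s : {perm T},
    forall x y, (x, y) \in enum [pred u | R u.1 u.2] -> s x = y.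
  by exists s => x y Rxy; apply: sR; rewrite mem_enum.
have: all [pred u | R u.1 u.2] (enum [pred u | R u.1 u.2]).
  by apply/allP=> u; rewrite mem_enum.
have := enum_uniq [pred u | R u.1 u.2].
elim: (enum _) => [|[x y] r IHr] /=; first by exists 1%g.
case/andP=> xyr ur /andP[Rxy /[dup] /allP Rr /(IHr ur)[s sr]].
(* The transposition corrects the image of [x]. The images of the earlier pairs are neither [s x]
   nor [y], as [R] is functional and injective. *)
exists (s * tperm (s x) y)%g => x' y'; rewrite inE permM.
case/predU1P=> [[-> ->]|x'y']; first by rewrite tpermL.
have Rx'y' : R x' y' := Rr _ x'y'.
rewrite (sr _ _ x'y') tpermD //; apply: contraNneq xyr.
  rewrite -(sr _ _ x'y') => /perm_inj xx'.
  by rewrite xx' in Rxy *; rewrite (R_fun Rxy Rx'y').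
by move=> yy'; rewrite yy' in Rxy *; rewrite (R_inj Rxy Rx'y').
Qed.

End PartialInjection.

(* A nontrivial reduced word of length m acts on the path 0, ..., m: its j-th
   letter moves j to j + 1. *)
Lemma free_group_residually_finite (k : nat) (w : free_group k) : w <> 1%g ->
  exists s : 'I_k -> 'S_(flength w).+1, eval s w <> 1%g.
Proof.
case: w => w redw; rewrite /flength /= => w1.
set m := size w.
have m_gt0 : 0 < m.
  by rewrite lt0n size_eq0; apply/eqP=> w0; apply: w1; apply: val_inj.
pose step (a : letter k) (x y : nat) :=
  (y == x.+1) && (x < m) && (nth a w x == a).
pose R i (x y : 'I_m.+1) := step (i, false) x y || step (i, true) y x.
(* A clash between a letter and an inverse letter in the relations [R i] would need adjacent
   mutually inverse letters. *)
have redw_nth a b x : x.+1 < m -> nth a w x.+1 != linv (nth b w x).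
  move=> lt_x; rewrite (set_nth_default a b) ?(ltnW lt_x) //.
  exact: (sortedP a redw).
have /choice[s sR] : forall i, exists s : 'S_m.+1, forall x y, R i x y -> s x = y.
  move=> i; apply: perm_extension.
    move=> x y z /orP[] /andP[/andP[/eqP xy ltm] wxy];
      case/orP=> /andP[/andP[/eqP xz ltm'] wxz]; apply: val_inj => /=.
    - by rewrite xy xz.
    - rewrite xz in wxy ltm; have := redw_nth (i, false) (i, true) _ ltm.
      by rewrite (eqP wxy) (eqP wxz) eqxx.
    - rewrite xy in wxz ltm'; have := redw_nth (i, false) (i, true) _ ltm'.
      by rewrite (eqP wxy) (eqP wxz) eqxx.
    - by move: xy xz; lia.
  move=> x y z /orP[] /andP[/andP[/eqP xy ltm] wxy];
    case/orP=> /andP[/andP[/eqP xz ltm'] wxz]; apply: val_inj => /=.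
  - by move: xy xz; lia.
  - rewrite xy in wxz ltm'; have := redw_nth (i, true) (i, false) _ ltm'.
    by rewrite (eqP wxy) (eqP wxz) eqxx.
  - rewrite xz in wxy ltm; have := redw_nth (i, true) (i, false) _ ltm.
    by rewrite (eqP wxy) (eqP wxz) eqxx.
  - by rewrite xy xz.
exists s => evw1.
(* Permutations compose from left to right, so prefixes act first and carry 0 along the path; [w]
   itself sends 0 to [m]. *)
suff /(_ m (leqnn m)): forall j, j <= m ->
    ((\prod_(a <- take j w) eval_letter s a)%g ord0 : nat) = j.
  rewrite take_size (evw1 : (\prod_(a <- w) eval_letter s a)%g = 1%g) perm1 /=.
  by move=> /esym m0; rewrite m0 in m_gt0.
elim=> [|j IHj] lt_j; first by rewrite take0 big_nil perm1.
have a0 : letter k by move: m_gt0; rewrite /m; case: (w).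
rewrite (take_nth a0) // big_rcons /= permM.
move: (fun_of_perm _ ord0) (IHj (ltnW lt_j)) => x xj.
have lt_j1 : j.+1 < m.+1 by [].
suff -> : eval_letter s (nth a0 w j) x = Ordinal lt_j1 by [].
case E: (nth a0 w j) => [i [|]] /=; rewrite /eval_letter /=.
  apply: (@perm_inj _ (s i)); rewrite permKV; apply/esym/sR.
  rewrite /R /step /= xj eqxx lt_j.
  by rewrite (set_nth_default a0 (i, true)) // E eqxx orbT.
by apply: sR; rewrite /R /step /= xj eqxx lt_j (set_nth_default a0) // E eqxx.
Qed.

(** * Elementary amenable subgroups *)

Definition subgroup_set (G : groupType) (P : set G) : Prop :=
  P 1%g /\ forall x y, P x -> P y -> P (x * y^-1)%g.

Record subgroup_of (G : groupType) (P : set G) (sgP : subgroup_set P) : Type :=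
  Subgroup { subgroup_val : G; _ : `[< P subgroup_val >] }.

Section SubgroupType.
Variables (G : groupType) (P : set G) (sgP : subgroup_set P).

HB.instance Definition _ := [isSub for @subgroup_val G P sgP].
HB.instance Definition _ := [Choice of subgroup_of sgP by <:].

Lemma subgroup_of_closed : group_closed (fun x => `[< P x >]).
Proof.
case: sgP => P1 PV; split=> [|x y /asboolP Px /asboolP Py]; apply/asboolP => //.
exact: PV.
Qed.

HB.instance Definition _ :=
  SubChoice_isSubGroup.Build G _ (subgroup_of sgP) subgroup_of_closed.

Lemma subgroup_ofP (x : subgroup_of sgP) : P (val x).
Proof. by case: x => x Px; apply/asboolP. Qed.

Definition in_subgroup (x : G) (Px : P x) : subgroup_of sgP :=
  Subgroup sgP (asboolT Px).

End SubgroupType.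

Section SubgroupMap.
Variables (G H : groupType) (P : set G) (sgP : subgroup_set P).
Variables (Q : set H) (sgQ : subgroup_set Q) (f : G -> H).
Hypotheses (fPQ : forall x, P x -> Q (f x))
  (fM : forall x y, P x -> P y -> f (x * y)%g = (f x * f y)%g).

(** Multiplicativity on [P] is the right generality: a coordinate [count_at] or [lamp] is a
    homomorphism on unshifted elements, not on the whole lamplighter group. *)
Definition subgroup_map (x : subgroup_of sgP) : subgroup_of sgQ :=
  in_subgroup sgQ (fPQ (subgroup_ofP x)).

Lemma subgroup_mapM : {morph subgroup_map : x y / (x * y)%g}.
Proof.
move=> x y; apply: val_inj.
exact: fM (subgroup_ofP x) (subgroup_ofP y).
Qed.

HB.instance Definition _ := isMultiplicative.Build _ _ subgroup_map subgroup_mapM.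

Definition subgroup_hom : {multiplicative subgroup_of sgP -> subgroup_of sgQ} :=
  subgroup_map.

End SubgroupMap.
Arguments subgroup_hom {G H P} sgP {Q} sgQ {f}.

Definition ea_set (G : groupType) (P : set G) : Prop :=
  exists sgP : subgroup_set P, elementary_amenable (subgroup_of sgP).

Section ElementaryAmenableSubgroups.
Variable G : groupType.
Implicit Types P Q : set G.

Lemma ea_subset P Q : subgroup_set P -> P `<=` Q -> ea_set Q -> ea_set P.
Proof.
move=> sgP PQ [sgQ eaQ]; exists sgP.
pose i : {multiplicative subgroup_of sgP -> subgroup_of sgQ} :=
  subgroup_hom sgP sgQ PQ (fun _ _ _ _ => erefl).
apply: (@EA_subgroup _ _ i) eaQ => x y /(congr1 (@subgroup_val _ _ _)) xy.
exact: val_inj.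
Qed.

Lemma ea_set1 : ea_set [set 1%g : G].
Proof.
have sg1 : subgroup_set [set 1%g : G].
  by split=> // x y -> ->; rewrite mulgV.
exists sg1; apply: EA_finite.
apply: (@sub_finite_set _ _ [set in_subgroup sg1 (erefl 1%g)]) (finite_set1 _).
by move=> x _; apply: val_inj; apply: (subgroup_ofP x).
Qed.

Lemma ea_ker (Q : groupType) (q : G -> Q) P : subgroup_set P ->
  (forall x y, P x -> P y -> q (x * y)%g = (q x * q y)%g) ->
  elementary_amenable Q -> ea_set [set x | P x /\ q x = 1%g] -> ea_set P.
Proof.
move=> sgP qM eaQ [sgK eaK]; exists sgP.
have [P1 PV] := sgP.
have q1 : q 1%g = 1%g by apply: (mulgI (q 1%g)); rewrite -qM // !mulg1.
have qP (x : G) : P x -> (q @` P) (q x) by exists x.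
have sgI : subgroup_set (q @` P).
  split=> [|_ _ [x Px <-] [y Py <-]]; first by exists 1%g.
  exists (x * y^-1)%g; first exact: PV.
  apply: (mulIg (q y)); rewrite -qM ?PV //; last exact: PV.
  by rewrite !mulgVK.
pose i : {multiplicative subgroup_of sgK -> subgroup_of sgP} :=
  subgroup_hom sgK sgP (fun x => @proj1 (P x) (q x = 1%g)) (fun _ _ _ _ => erefl).
pose p : {multiplicative subgroup_of sgP -> subgroup_of sgI} :=
  subgroup_hom sgP sgI qP qM.
pose j : {multiplicative subgroup_of sgI -> Q} := val.
apply: (@EA_extension _ _ _ i p) eaK _.
- by move=> x y /(congr1 (@subgroup_val _ _ _)) xy; apply: val_inj.
- move=> y; have [x Px qx] := subgroup_ofP y.
  by exists (in_subgroup sgP Px); apply: val_inj.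
- move=> x; split=> [/(congr1 (@subgroup_val _ _ _)) qx|[y <-]]; last first.
    by apply: val_inj; have [] := subgroup_ofP y.
  have Kx : [set x | P x /\ q x = 1%g] (val x) by split; [exact: subgroup_ofP|].
  by exists (in_subgroup sgK Kx); apply: val_inj.
- exact: (@EA_subgroup _ _ j val_inj).
Qed.

(** The union is the directed limit along inclusions. A cocone induces a map by evaluating at any
    stage containing the element; [uE] shows that the stage does not matter. *)
Lemma ea_chain (P_ : nat -> set G) P : (forall n, ea_set (P_ n)) ->
  (forall m n, m <= n -> P_ m `<=` P_ n) ->
  (forall x, P x <-> exists n, P_ n x) -> ea_set P.
Proof.
move=> eaP leP PE.
have sgP_ n : subgroup_set (P_ n) by case: (eaP n).
have eaP_ n : elementary_amenable (subgroup_of (sgP_ n)).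
  by case: (eaP n) => sgPn; rewrite (Prop_irrelevance sgPn (sgP_ n)).
have sgP : subgroup_set P.
  split=> [|x y /PE[m Px] /PE[n Py]]; first by apply/PE; exists 0; case: (sgP_ 0).
  apply/PE; exists (maxn m n); apply: (sgP_ _).2.
    exact: leP (leq_maxl _ _) _ Px.
  exact: leP (leq_maxr _ _) _ Py.
exists sgP.
have PP n : P_ n `<=` P by move=> x Px; apply/PE; exists n.
pose incl m n (le_mn : m <= n) :=
  subgroup_hom (sgP_ m) (sgP_ n) (leP m n le_mn) (fun _ _ _ _ => erefl).
pose phi n := subgroup_hom (sgP_ n) sgP (PP n) (fun _ _ _ _ => erefl).
have incl_id n (nn : n <= n) x : incl n n nn x = x by apply: val_inj.
have incl_comp l m n (lm : l <= m) (mn : m <= n) (ln : l <= n) x :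
  incl m n mn (incl l m lm x) = incl l n ln x by apply: val_inj.
pose D := DirectedSystem (inhabits 0) leqnn (fun i j l => @leq_trans i j l)
  (fun i j => ex_intro2 _ _ (maxn i j) (leq_maxl i j) (leq_maxr i j))
  incl_id incl_comp.
apply: (@EA_directed_limit D _ phi) => //; split=> [i j ij x|H psi psiE].
  exact: val_inj.
have lift (x : subgroup_of sgP) : exists n, P_ n (val x).
  by apply/PE/(subgroup_ofP x).
have [N PN] := choice lift.
pose u x : H := psi (N x) (in_subgroup (sgP_ _) (PN x)).
have uE n (x : subgroup_of sgP) (Px : P_ n (val x)) :
    u x = psi n (in_subgroup (sgP_ n) Px).
  rewrite /u -(psiE _ _ (leq_maxl (N x) n)) -(psiE _ _ (leq_maxr (N x) n)).
  by congr (psi _ _); apply: val_inj.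
have uM : {morph u : x y / (x * y)%g}.
  move=> x y; pose n := maxn (N x) (N y).
  have Px : P_ n (val x) := leP _ _ (leq_maxl _ _) _ (PN x).
  have Py : P_ n (val y) := leP _ _ (leq_maxr _ _) _ (PN y).
  rewrite (uE n x Px) (uE n y Py) -gmulfM.
  have Pxy : P_ n (val (x * y)%g) :=
    subgroup_ofP (in_subgroup (sgP_ n) Px * in_subgroup (sgP_ n) Py)%g.
  by rewrite (uE n _ Pxy); congr (psi _ _); apply: val_inj.
pose uMul := isMultiplicative.Build _ _ u uM.
pose U : {multiplicative subgroup_of sgP -> H} := HB.pack u uMul.
exists U; split=> [n x|v vE x] /=.
  have Px : P_ n (val (phi n x)) := subgroup_ofP x.
  by rewrite (uE n _ Px); congr (psi _ _); apply: val_inj.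
by rewrite /u -vE; congr (v _); apply: val_inj.
Qed.


(** Enumerate the coordinates. The elements whose coordinates vanish from code [n] on form a chain,
    which exhausts [P] by finiteness of supports; each stage extends the previous one by a subgroup
    of some [Q j]. *)
Lemma ea_tower (I : countType) (Q : I -> groupType) (q : forall i, G -> Q i) P :
  subgroup_set P ->
  (forall i x y, P x -> P y -> q i (x * y)%g = (q i x * q i y)%g) ->
  (forall i, elementary_amenable (Q i)) ->
  (forall x, P x -> exists s : seq I, forall i, q i x <> 1%g -> i \in s) ->
  ea_set [set x | P x /\ forall i, q i x = 1%g] -> ea_set P.
Proof.
move=> sgP qM eaQ q_supp eaK; have [P1 PV] := sgP.
have q1 i : q i 1%g = 1%g by apply: (mulgI (q i 1%g)); rewrite -qM // !mulg1.
have qV i x y : P x -> P y -> q i x = 1%g -> q i y = 1%g ->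
    q i (x * y^-1)%g = 1%g.
  move=> Px Py qx qy; apply: (mulIg (q i y)).
  by rewrite -qM ?mulgVK ?qx ?qy ?mulg1 //; apply: PV.
pose P_ n := [set x | P x /\ forall i, n <= pickle i -> q i x = 1%g].
have leP m n : m <= n -> P_ m `<=` P_ n.
  by move=> le_mn x [Px qx]; split=> // i le_ni; apply/qx/(leq_trans le_mn).
apply: (@ea_chain P_) => // [n|x]; last first.
  split=> [Px|[n []//]]; have [s sP] := q_supp x Px.
  exists (\max_(i <- s) pickle i).+1; split=> // i.
  apply: contraTeq => /eqP/sP si.
  by rewrite -ltnNge ltnS; apply: leq_bigmax_seq.
elim: n => [|n IHn].
  congr ea_set: eaK; apply/seteqP; split=> x [Px qx]; split=> // i; exact: qx.
have sgPn : subgroup_set (P_ n.+1).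
  split=> [//|x y [Px qx] [Py qy]]; split=> [|i le_ni]; first exact: PV.
  by apply: qV => //; [apply: qx | apply: qy].
case E: (@pickle_inv I n) => [j|]; last first.
  apply: ea_subset IHn => // x [Px qx]; split=> // i; rewrite leq_eqVlt.
  by case/predU1P=> [ni|/qx//]; rewrite ni pickleK_inv in E.
have nj : pickle j = n by have := @pickle_invK I n; rewrite /ocancel E.
apply: (ea_ker (q := q j)) => // [x y [Px _] [Py _]|]; first exact: qM.
apply: ea_subset IHn; last first.
  move=> x [[Px qx] qjx]; split=> // i; rewrite leq_eqVlt.
  case/predU1P=> [ni|/qx//]; suff -> : i = j by [].
  by apply: (pcan_inj pickleK); rewrite nj.
split=> [//|x y [Px qx] [Py qy]]; split; first exact: sgPn.2.
by apply: qV => //; [case: Px | case: Py].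
Qed.

End ElementaryAmenableSubgroups.

(** * The lamplighter group *)

Definition expgz (G : groupType) (x : G) (m : int) : G :=
  match m with Posz n => x ^+ n | Negz n => x ^- n.+1 end%g.

Lemma expgz0 (G : groupType) (x : G) : expgz x 0%R = 1%g.
Proof. exact: expg0. Qed.

Lemma expgzS (G : groupType) (x : G) (m : int) :
  expgz x (m + 1)%R = (expgz x m * x)%g.
Proof.
case: m => [n|[|n]]; first by rewrite /= addn1 expgSr.
  by rewrite /= mulVg.
have -> : (Negz n.+1 + 1)%R = Negz n by lia.
by rewrite /expgz [in RHS]expgS invgM mulgVK.
Qed.

Lemma expgzD (G : groupType) (x : G) (m n : int) :
  expgz x (m + n)%R = (expgz x m * expgz x n)%g.
Proof.
elim/int_rect: n => [|n IHn|n IHn]; first by rewrite GRing.addr0 expgz0 mulg1.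
  by rewrite -addn1 PoszD GRing.addrA !expgzS IHn mulgA.
apply: (mulIg x); rewrite -mulgA -!expgzS.
have -> : (- n.+1%:Z + 1 = - n%:Z)%R by lia.
by have -> : (m - n.+1%:Z + 1 = m - n%:Z)%R by lia.
Qed.

Lemma expgzN (G : groupType) (x : G) (m : int) : expgz x (- m)%R = (expgz x m)^-1%g.
Proof. by apply: (mulgI (expgz x m)); rewrite mulgV -expgzD GRing.subrr. Qed.

(* The semidirect product of a product of copies of H n, and of two further
   copies of the integers, indexed by the integers, with the integers acting by
   translation. [count_at g false] and [count_at g true] record the net numbers
   of first and second toggles at each position. *)
Record lamplighter (H : nat -> groupType) : Type := Lamplighter {
  shift : int;
  count_at : bool -> int -> int;
  lamp : forall n, int -> H n }.

Section LamplighterGroup.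
Variable H : nat -> groupType.
Implicit Types g h : lamplighter H.
Local Open Scope ring_scope.

HB.instance Definition _ := gen_eqMixin (lamplighter H).
HB.instance Definition _ := gen_choiceMixin (lamplighter H).

Lemma lamplighter_ext g h : shift g = shift h ->
  (forall s x, count_at g s x = count_at h s x) ->
  (forall n x, lamp g n x = lamp h n x) -> g = h.
Proof.
case: g h => [m c l] [m' c' l'] /= -> cE lE; congr Lamplighter.
  by apply/funext=> s; apply/funext=> x.
by apply: functional_extensionality_dep => n; apply/funext=> x.
Qed.

Definition lamplighter_one : lamplighter H :=
  Lamplighter 0 (fun _ _ => 0) (fun _ _ => 1%g).

Definition lamplighter_mul g h : lamplighter H :=
  Lamplighter (shift g + shift h)
    (fun s x => count_at g s x + count_at h s (x - shift g))
    (fun n x => lamp g n x * lamp h n (x - shift g))%g.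

Definition lamplighter_inv g : lamplighter H :=
  Lamplighter (- shift g)
    (fun s x => - count_at g s (x + shift g))
    (fun n x => (lamp g n (x + shift g))^-1)%g.

Fact lamplighter_mulA : associative lamplighter_mul.
Proof.
move=> g h k; apply: lamplighter_ext => [|s x|n x] /=; first exact: addrA.
  by rewrite addrA opprD addrA.
by rewrite mulgA opprD addrA.
Qed.

Fact lamplighter_mul1g : left_id lamplighter_one lamplighter_mul.
Proof.
move=> g; apply: lamplighter_ext => [|s x|n x] /=; first exact: add0r.
  by rewrite add0r subr0.
by rewrite mul1g subr0.
Qed.

Fact lamplighter_mulg1 : right_id lamplighter_one lamplighter_mul.
Proof.
move=> g; apply: lamplighter_ext => [|s x|n x] /=; first exact: addr0.
  exact: addr0.
exact: mulg1.
Qed.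

Fact lamplighter_mulVg :
  left_inverse lamplighter_one lamplighter_inv lamplighter_mul.
Proof.
move=> g; apply: lamplighter_ext => [|s x|n x] /=; first exact: addNr.
  by rewrite opprK addNr.
by rewrite opprK mulVg.
Qed.

Fact lamplighter_mulgV :
  right_inverse lamplighter_one lamplighter_inv lamplighter_mul.
Proof.
move=> g; apply: lamplighter_ext => [|s x|n x] /=; first exact: addrN.
  by rewrite subrK addrN.
by rewrite subrK mulgV.
Qed.

HB.instance Definition _ := isGroup.Build (lamplighter H)
  lamplighter_mulA lamplighter_mul1g lamplighter_mulg1
  lamplighter_mulVg lamplighter_mulgV.

End LamplighterGroup.

(** * Elements of bounded radius *)

Section Confined.
Variables (H : nat -> groupType) (a : forall n, bool -> H n) (p : nat -> nat).
Implicit Types g h : lamplighter H.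
Local Open Scope ring_scope.

Lemma shiftM g h : shift (g * h)%g = shift g + shift h. Proof. by []. Qed.
Lemma shiftV g : shift g^-1%g = - shift g. Proof. by []. Qed.

Lemma count_atM g h s x :
  count_at (g * h)%g s x = count_at g s x + count_at h s (x - shift g).
Proof. by []. Qed.

Lemma lampM g h n x :
  lamp (g * h)%g n x = (lamp g n x * lamp h n (x - shift g))%g.
Proof. by []. Qed.

(** This records what a word of length about [r] can do. If [2 * r < p n], the intervals of radius
    [r] around 0 and around [p n], where the two toggles can reach lamp n, are disjoint; each lamp n
    then sees only one of the two toggles, and the counts determine it. *)
Definition confined (r : nat) g : Prop :=
  [/\ (`|shift g| <= r)%N,
      forall s x, (r < `|x|)%N -> count_at g s x = 0,
      forall n x, (r + p n < `|x|)%N -> lamp g n x = 1%g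
    & forall n x, (2 * r < p n)%N ->
        lamp g n x = (expgz (a n false) (count_at g false x)
                      * expgz (a n true) (count_at g true (x - (p n)%:Z)))%g].

Lemma confined_le r s g : (r <= s)%N -> confined r g -> confined s g.
Proof.
move=> le_rs [g_sh g_ct g_lp g_eq]; split=> [|i x xs|n x xs|n x ps].
- exact: leq_trans le_rs.
- by apply: g_ct; lia.
- by apply: g_lp; lia.
- by apply: g_eq; lia.
Qed.

Lemma confined1 : confined 0 (1%g : lamplighter H).
Proof. by split=> // n x _; rewrite expgz0 mulg1. Qed.

Lemma confinedM r s g h :
  confined r g -> confined s h -> confined (r + s) (g * h)%g.
Proof.
move=> [g_sh g_ct g_lp g_eq] [h_sh h_ct h_lp h_eq].
split=> [|i x xrs|n x xrs|n x prs].
- by rewrite shiftM; lia.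
- by rewrite count_atM g_ct ?h_ct ?addr0 //; lia.
- by rewrite lampM g_lp ?h_lp ?mulg1 //; lia.
rewrite lampM g_eq ?h_eq ?count_atM ?expgzD; try lia.
rewrite addrAC -!mulgA; congr mul; rewrite !mulgA; congr mul.
(* The second toggles of [g] must pass the first toggles of [h]; one of these two powers is trivial,
   since [p n] is too large for [x] to be near both intervals. *)
have [lt_x|le_x] := ltnP r `|x - (p n)%:Z|.
  by rewrite (g_ct _ _ lt_x) expgz0 mul1g mulg1.
by rewrite (h_ct false) ?expgz0 ?mul1g ?mulg1 //; lia.
Qed.

(** The radius doubles because the inverse reads its data at [x + shift g]. *)
Lemma confinedV r g : confined r g -> confined (2 * r) g^-1%g.
Proof.
move=> [g_sh g_ct g_lp g_eq]; split=> [|i x xr|n x xr|n x pr] /=.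
- by rewrite abszN; lia.
- by rewrite g_ct ?oppr0 //; lia.
- by rewrite g_lp ?invg1 //; lia.
rewrite g_eq ?invgM -?expgzN; last by lia.
have -> : x - (p n)%:Z + shift g = x + shift g - (p n)%:Z by rewrite addrAC.
have [lt_x|le_x] := ltnP r `|x + shift g|.
  by rewrite (g_ct _ _ lt_x) oppr0 expgz0 mul1g mulg1.
by rewrite (g_ct true) ?oppr0 ?expgz0 ?mul1g ?mulg1 //; lia.
Qed.

Lemma confined_prod (I : eqType) (s : seq I) (F : I -> lamplighter H) r :
  (forall i, i \in s -> confined r (F i)) ->
  confined (size s * r) (\prod_(i <- s) F i)%g.
Proof.
elim: s => [|i s IHs] Fr; first by rewrite big_nil; apply: confined1.
rewrite big_cons mulSn; apply: confinedM; first by apply: Fr; rewrite mem_head.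
by apply: IHs => j sj; apply: Fr; rewrite inE sj orbT.
Qed.

Definition walk : lamplighter H := Lamplighter 1 (fun _ _ => 0) (fun _ _ => 1%g).

(** Both toggles are counted at the walker's position 0, although the second acts at [p n]; hence
    the [x - p n] in [confined]. *)
Definition toggle (s : bool) : lamplighter H :=
  Lamplighter 0 (fun s' x => ((s' == s) && (x == 0))%:Z)
    (fun n x => if x == (s * p n)%:Z then a n s else 1%g).

Lemma confined_walk : confined 1 walk.
Proof. by split=> // n x _; rewrite expgz0 mulg1. Qed.

Lemma confined_toggle s : confined 0 (toggle s).
Proof.
split=> //= [s' x|n x|n x pn].
- by rewrite absz_gt0 => /negPf->; rewrite andbF.
- by case: eqP => // -> ; case: s; lia.
case: s; rewrite ?mul1n ?mul0n /= ?expgz0 ?mul1g ?mulg1 ?subr_eq0.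
  by case: eqP => //= _; rewrite ?expgz0 ?mulg1.
by case: eqP => //= _; rewrite ?expgz0 ?mulg1.
Qed.

End Confined.

Definition int_ball (r : nat) : seq int :=
  [seq k%:Z - r%:Z | k <- iota 0 (2 * r).+1]%R.

Lemma mem_int_ball (r : nat) (x : int) : `|x| <= r -> x \in int_ball r.
Proof.
move=> xr; apply/mapP; exists (absz (x + r%:Z)%R); last by lia.
by rewrite mem_iota; lia.
Qed.

(** * Elementary amenability of the confined elements *)

Section ElementaryAmenable.
Variables (H : nat -> groupType) (a : forall n, bool -> H n) (p : nat -> nat).
Hypotheses (eaH : forall n, elementary_amenable (H n))
  (p_ge : forall n, n <= p n).

Lemma subgroup_confined : subgroup_set [set g | exists r, confined a p r g].
Proof.
split=> [|g h [r rg] [s sh]]; first by exists 0; apply: confined1.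
by exists (r + 2 * s); apply: confinedM => //; apply: confinedV.
Qed.

(** Three layers are peeled off: the shift, then the counts, then the lamps. Once the shift
    vanishes, the remaining coordinates are homomorphisms. *)
Lemma ea_confined : ea_set [set g | exists r, confined a p r g].
Proof.
have sgP := subgroup_confined; set P := [set g | _] in sgP *.
apply: (ea_ker (Q := int_group) (q := @shift H)) => //; first exact: EA_int.
set P1 := [set g | _].
have sgP1 : subgroup_set P1.
  split=> [|g h [Pg g0] [Ph h0]]; first by split=> //; apply: sgP.1.
  split; first exact: sgP.2.
  by rewrite shiftM shiftV g0 h0.
have P1M g x : P1 g -> (x - shift g = x)%R by move=> [_ ->]; exact: subr0.
apply: (ea_tower (I := (bool * int)%type) (Q := fun _ => int_group)
    (q := fun i g => count_at g i.1 i.2)) => //.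
- by move=> [s x] g h P1g _; rewrite count_atM P1M.
- by move=> _; apply: EA_int.
- move=> g [[r [_ g_ct _ _]] _].
  exists [seq (s, x) | s <- [:: false; true], x <- int_ball r].
  move=> [s x] gsx; apply/allpairsPdep; exists s, x; split=> //.
    by case: s {gsx}.
  by apply/mem_int_ball; rewrite leqNgt; apply/negP => /g_ct.
set P2 := [set g | _].
have sgP2 : subgroup_set P2.
  split=> [|g h [Pg g0] [Ph h0]]; first by split=> //; apply: sgP1.1.
  split=> [|i]; first exact: sgP1.2.
  rewrite count_atM /= (g0 (_, _)) (h0 (_, _)); exact: subr0.
apply: (ea_tower (I := (nat * int)%type) (Q := fun i => H i.1)
    (q := fun i g => lamp g i.1 i.2)) => //.
- by move=> [n x] g h [P1g _] _; rewrite lampM P1M.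
(* With zero counts, lamp n is off whenever [2 * r < p n]; as [n <= p n], only finitely many kinds
   of lamps remain. *)
- move=> g [[[r [_ g_ct g_lp g_eq]] _] g0].
  pose M := \max_(n < (2 * r).+1) p n.
  exists [seq (n, x) | n <- iota 0 (2 * r).+1, x <- int_ball (r + M)].
  move=> [n x] gnx; apply/allpairsPdep; exists n, x.
  have le_n : n < (2 * r).+1.
    rewrite ltnS leqNgt; apply/negP=> lt_n; apply: gnx; rewrite g_eq.
      by rewrite (g0 (_, _)) (g0 (_, _)) !expgz0 mulg1.
    exact: leq_trans (p_ge n).
  split=> //; first by rewrite mem_iota.
  apply: mem_int_ball; apply: (@leq_trans (r + p n)).
    by rewrite leqNgt; apply/negP=> /g_lp.
  by rewrite leq_add2l (leq_bigmax (Ordinal le_n)).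
apply: ea_subset (ea_set1 _).
  split=> [|g h [Pg g0] [Ph h0]]; first by split=> //; apply: sgP2.1.
  split=> [|i]; first exact: sgP2.2.
  by rewrite lampM /= (g0 (_, _)) (h0 (_, _)) invg1 mulg1.
move=> g [[[_ g_sh] g_ct] g_lp]; apply: lamplighter_ext => [|s x|n x] //.
  exact: g_ct (s, x).
exact: g_lp (n, x).
Qed.

End ElementaryAmenable.

(** * The law and the generated group *)

Section Eval.
Variable k : nat.
Implicit Type w : free_group k.

Lemma val_eval (G : groupType) (P : set G) (sgP : subgroup_set P)
    (g : 'I_k -> subgroup_of sgP) w :
  val (eval g w) = eval (fun i => val (g i)) w.
Proof.
rewrite /eval; elim: (fword w) => [|[i b] s IHs]; first by rewrite !big_nil.
by rewrite !big_cons -IHs; case: b.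
Qed.

Section CommutatorPower.
Variables (i j : 'I_k).
Hypothesis neq_ij : i != j.
Let x : letter k := (i, false).
Let y : letter k := (j, false).
Let x' : letter k := (i, true).
Let y' : letter k := (j, true).

(** This spells [[~ [~ x, y], [~ x^-1, y^-1]]] with [[~ u, v]] read as [u^-1 v^-1 u v]. The inverses
    in the second commutator prevent any cancellation, also between consecutive copies. *)
Let comm_word : seq (letter k) :=
  [:: y'; x'; y; x; y; x; y'; x'; x'; y'; x; y; x; y; x'; y'].

Let comm_power_reduced e : reduced (flatten (nseq e comm_word)).
Proof.
(* Each copy ends in [y'], so starting the path there covers the junctions. *)
suff: path (fun a b => b != linv a) y' (flatten (nseq e comm_word)).
  exact: path_sorted.
elim: e => //= e ->.
by rewrite !xpair_eqE !eqxx (eq_sym j i) (negPf neq_ij).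
Qed.

Lemma commutator_power_word e : 0 < e -> exists w : free_group k,
  [/\ w <> 1%g, flength w = 16 * e & forall (G : groupType) (g : 'I_k -> G),
    eval g w = ([~ [~ g i, g j], [~ (g i)^-1, (g j)^-1]] ^+ e)%g].
Proof.
move=> e_gt0; exists (FreeWord (comm_power_reduced e)).
have size_w : size (flatten (nseq e comm_word)) = 16 * e.
  by rewrite size_flatten /shape map_nseq sumn_nseq.
split=> [/(congr1 (@flength k))||G g] //.
  by rewrite [flength _]size_w [RHS](erefl 0); lia.
rewrite /eval /=; elim: (e) => [|n IHn]; first by rewrite big_nil.
have -> : flatten (nseq n.+1 comm_word)
          = comm_word ++ flatten (nseq n comm_word) by [].
rewrite big_cat IHn expgS; congr mul => /=.
rewrite !big_cons big_nil mulg1 /eval_letter /=.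
by rewrite /commg /conjg !invgM !invgK !mulgA.
Qed.

End CommutatorPower.

End Eval.

Section Exponents.
Variable H : nat -> groupType.
Implicit Types g h : lamplighter H.
Local Open Scope ring_scope.

Lemma shift_commg g h : shift [~ g, h]%g = 0.
Proof. by rewrite /=; lia. Qed.

Lemma count_at_commg g h s x : shift g = 0 -> shift h = 0 ->
  count_at [~ g, h]%g s x = 0.
Proof.
move=> g0 h0; rewrite /= g0 h0.
by rewrite ?(oppr0, subr0, addr0); lia.
Qed.

Lemma unshifted_exp g e : shift g = 0 -> (forall s x, count_at g s x = 0) ->
  [/\ shift (g ^+ e)%g = 0, forall s x, count_at (g ^+ e)%g s x = 0
    & forall n x, lamp (g ^+ e)%g n x = (lamp g n x ^+ e)%g].
Proof.
move=> g0 c0; elim: e => [//|e [IHs IHc IHl]]; split=> [|s x|n x].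
- by rewrite expgS shiftM g0 IHs.
- by rewrite expgS count_atM c0 IHc.
- by rewrite !expgS lampM g0 subr0 IHl.
Qed.

Lemma lamp_eval (k : nat) (g : 'I_k -> lamplighter H) (w : free_group k) n x :
  (forall i, shift (g i) = 0) ->
  lamp (eval g w) n x = eval (fun i => lamp (g i) n x) w.
Proof.
move=> g0; rewrite /eval.
elim: (fword w) => [|[i b] s IHs]; first by rewrite !big_nil.
rewrite !big_cons lampM -IHs; congr mul.
  by case: b; rewrite /eval_letter //= g0 addr0.
by case: b; rewrite /eval_letter /= g0 ?oppr0 subr0.
Qed.

Lemma exp_walk m : shift (walk H ^+ m)%g = m%:Z /\
  forall n x, lamp (walk H ^+ m)%g n x = 1%g.
Proof.
elim: m => [//|m [IHs IHl]]; split=> [|n x].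
  by rewrite expgS shiftM IHs /=; lia.
by rewrite expgS lampM IHl mulg1.
Qed.

End Exponents.

(** * Subgroups generated by a set *)

Section Generated.
Variables (G : groupType) (T : set G).

Definition generated_set : set G :=
  [set x | exists2 s : seq G, is_word T s & (\prod_(y <- s) y)%g = x].

Lemma subgroup_generated : subgroup_set generated_set.
Proof.
split=> [|x y [s Ts <-] [r Tr <-]]; first by exists [::]; rewrite ?big_nil.
exists (s ++ [seq z^-1%g | z <- rev r]).
  move=> z; rewrite mem_cat => /orP[/Ts //|/mapP[t]].
  by rewrite mem_rev => /Tr[Tt|Tt] ->; [right; rewrite invgK|left].
by rewrite big_cat big_map prodgV revK.
Qed.

Definition generated_groupType : groupType := subgroup_of subgroup_generated.

Definition generators : set generated_groupType := [set x | T (val x)].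

Lemma generates_generated : generates generators.
Proof.
move=> x; have [s] := subgroup_ofP x.
elim: s x => [|y s IHs] x Ts sx.
  by exists [::] => //; apply: val_inj; rewrite -sx !big_nil.
have Tgen z : T z -> generated_set z.
  by exists [:: z]; rewrite ?big_seq1 // => t; rewrite inE => /eqP->; left.
have [y0 yy0 Sy0] : exists2 y0 : generated_groupType, val y0 = y &
    generators y0 \/ generators y0^-1%g.
  have [Ty|Ty] := Ts y (mem_head _ _).
    by exists (in_subgroup subgroup_generated (Tgen _ Ty)) => //; left.
  exists (in_subgroup subgroup_generated (Tgen _ Ty))^-1%g; first exact: invgK.
  by right; rewrite invgK.
have [||r Sr rx] := IHs (y0^-1 * x)%g.
- by move=> z sz; apply: Ts; rewrite inE sz orbT.
- by rewrite -[RHS]/((val y0)^-1 * val x)%g yy0 -sx big_cons mulKg.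
exists (y0 :: r); last by rewrite big_cons rx mulVKg.
by move=> z; rewrite inE => /predU1P[-> //|/Sr].
Qed.

Lemma val_word_length (x : generated_groupType) : exists s,
  [/\ is_word T s, (\prod_(y <- s) y)%g = val x
    & size s = word_length generators x].
Proof.
have [s [Ss <- <-]] := word_lengthP x generates_generated.
exists (map val s); split; last exact: size_map.
  by move=> _ /mapP[y /Ss Sy ->].
by rewrite big_map; elim: s {Ss} => [|y s IHs]; rewrite ?big_nil // !big_cons IHs.
Qed.

Lemma finite_generators : finite_set T -> finite_set generators.
Proof. by apply: finite_preimage => x y _ _; apply: val_inj. Qed.

End Generated.

Section LamplighterSubgroup.
Variables (H : nat -> groupType) (a : forall n, bool -> H n) (p : nat -> nat).

Definition walk_toggles : set (lamplighter H) :=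
  [set walk H; toggle a p false; toggle a p true].

Local Notation Gamma := (generated_groupType walk_toggles).
Local Notation S := (@generators _ walk_toggles).

(** Generators have radius at most 1; the factor 2 pays for their inverses. *)
Lemma confined_word_length (x : Gamma) :
  confined a p (2 * word_length S x) (val x).
Proof.
have [s [Ts <- <-]] := val_word_length x.
rewrite mulnC; apply: confined_prod => y /Ts.
have T1 z : walk_toggles z -> confined a p 1 z.
  case=> [[]|] ->; first exact: confined_walk.
    by apply: confined_le (confined_toggle a p false).
  by apply: confined_le (confined_toggle a p true).
case=> /T1 cy; first exact: confined_le cy.
by rewrite -(invgK y); exact: (confinedV cy).
Qed.

Lemma ea_lamplighter_subgroup : (forall n, elementary_amenable (H n)) ->
  (forall n, n <= p n) -> elementary_amenable Gamma.
Proof.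
move=> eaH p_ge.
have [|sgT eaT] :=
  ea_subset (subgroup_generated walk_toggles) _ (ea_confined a eaH p_ge).
  move=> x Tx; exists (2 * word_length S (in_subgroup (subgroup_generated _) Tx)).
  exact: (confined_word_length (in_subgroup (subgroup_generated _) Tx)).
by rewrite /generated_groupType (Prop_irrelevance (subgroup_generated _) sgT).
Qed.

(** Conjugation by [t ^+ p n] brings lamp n of the second toggle from [p n] to 0. On unshifted
    elements, lamp n at 0 is a homomorphism, sending the two chosen elements to [a n false] and
    [a n true]. *)
Lemma lamplighter_subgroup_lawless :
  (forall w : free_group 2, w <> 1%g ->
     exists n, eval (fun i => a n (i == ord_max)) w <> 1%g) ->
  forall w : free_group 2, ~ is_law Gamma w.
Proof.
move=> resH w [w1 lawG]; have [n] := resH w w1; apply.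
have genT x : walk_toggles x -> generated_set walk_toggles x.
  by exists [:: x]; rewrite ?big_seq1 // => t; rewrite inE => /eqP->; left.
pose lift x Tx : Gamma :=
  in_subgroup (subgroup_generated walk_toggles) (genT x Tx).
pose t := lift (walk H) (or_introl (or_introl erefl)).
pose b0 := lift (toggle a p false) (or_introl (or_intror erefl)).
pose b1 := lift (toggle a p true) (or_intror erefl).
pose g (i : 'I_2) := if i == ord_max then (b1 ^ (t ^+ p n))%g else b0.
have valg (i : 'I_2) : val (g i) =
    if i == ord_max then (toggle a p true ^ (walk H ^+ p n))%g
    else toggle a p false.
  have valt : val (t ^+ p n)%g = (walk H ^+ p n)%g.
    by elim: (p n) => // m IHm; rewrite !expgS -IHm.
  by rewrite /g; case: ifP => // _; rewrite -valt.
have [tp_shift tp_lamp] := exp_walk H (p n).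
have := congr1 (fun h : Gamma => lamp (val h) n 0%R) (lawG g).
rewrite /= -[subgroup_val _]/(val (eval g w)) val_eval lamp_eval => [evw1|i].
  rewrite -[RHS]evw1; congr eval; apply/funext=> i; rewrite valg.
  case: ifP => _ /=; [|by []].
  rewrite !tp_lamp tp_shift; case: eqP => [_|[]]; last by rewrite mul1n; lia.
  by rewrite invg1 mul1g mulg1.
by rewrite valg; case: ifP => //= _; rewrite tp_shift; lia.
Qed.

(** The double commutator has zero shift and counts. Its [e]-th power has lamps n below [N] off by
    the exponent hypothesis, and the others off because confinement makes the zero counts determine
    them. *)
Lemma short_eval_trivial (k : nat) (i j : 'I_k) (w : free_group k) (e N : nat)
    (g : 'I_k -> Gamma) :
  flength w = 16 * e ->
  (forall (G : groupType) (h : 'I_k -> G),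
    eval h w = ([~ [~ h i, h j], [~ (h i)^-1, (h j)^-1]] ^+ e)%g) ->
  (forall n (y : H n), n < N -> (y ^+ e)%g = 1%g) ->
  (forall n, N <= n -> 128 * e * (\sum_l word_length S (g l)) < p n) ->
  eval g w = 1%g.
Proof.
move=> wl wE expH pN; apply: val_inj; rewrite val_eval.
set R := \sum_l _ in pN; set h := fun l => val (g l).
have ch l : confined a p (4 * R) (h l) /\ confined a p (4 * R) (h l)^-1%g.
  have cl : confined a p (2 * R) (h l).
    apply: confined_le (confined_word_length (g l)).
    by rewrite leq_mul2l /R (bigD1 l) ?leq_addr.
  split; first by apply: confined_le cl; rewrite leq_mul2r orbT.
  by have := confinedV cl; rewrite mulnA.
have [_ _ _] : confined a p (16 * e * (4 * R)) (eval h w).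
  rewrite -wl; apply: confined_prod => -[l b] _.
  by case: b; case: (ch l).
rewrite wE; set u := [~ _, _]%g => u_eq.
have u0 : shift u = 0%R := shift_commg _ _.
have uc s x : count_at u s x = 0%R by apply: count_at_commg; apply: shift_commg.
have [us ucs ul] := unshifted_exp e u0 uc.
apply: lamplighter_ext => // n x; have [lt_n|le_n] := ltnP n N.
  by rewrite ul expH.
by rewrite u_eq ?ucs ?expgz0 ?mulg1 //; have := pN n le_n; lia.
Qed.

End LamplighterSubgroup.

(* The n-th pair is chosen for the word with code n. *)
Lemma free_group2_quotients :
  exists (m : nat -> nat) (a : forall n, bool -> 'S_(m n)),
  forall w : free_group 2, w <> 1%g ->
    exists n, eval (fun i => a n (i == ord_max)) w <> 1%g.
Proof.
have quot n : exists q : {m & bool -> 'S_m}, forall w : free_group 2, w <> 1%g ->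
    pickle (fword w) = n -> eval (fun i => projT2 q (i == ord_max)) w <> 1%g.
  have [[w [w1 wn]]|no_w] := pselect (exists w : free_group 2,
      w <> 1%g /\ pickle (fword w) = n); last first.
    exists (existT (fun m => bool -> 'S_m) 0 (fun _ => 1%g)) => w w1 wn.
    by case: no_w; exists w.
  have [s sw] := free_group_residually_finite w1.
  exists (existT (fun m => bool -> 'S_m) (flength w).+1
    (fun b : bool => s (if b then ord_max else ord0))) => v _ vn /=.
  have -> : v = w by apply/val_inj/(pcan_inj pickleK); rewrite vn wn.
  congr (eval _ _ <> _): sw; apply/funext=> i; congr (s _).
  case: eqP => // ni; apply: val_inj.
  by case: i ni => [[|[|i]] lti] // [] //; apply: val_inj.
have [q qP] := choice quot.
exists (fun n => projT1 (q n)), (fun n => projT2 (q n)) => w w1.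
by exists (pickle (fword w)); apply: qP.
Qed.

(** * Choice of the parameters and the lower bound *)

Theorem theorem1p3 (f : nat -> nat)
    (f_pos : forall l : nat, 0 < l -> 0 < f l)
    (f_nondecreasing : forall l m : nat, 0 < l -> l <= m -> f l <= f m)
    (f_unbounded : forall M : nat, exists2 l : nat, 0 < l & M < f l) :
  exists (Gamma : groupType) (S : set Gamma),
    [/\ finite_set S, generates S, elementary_amenable Gamma, lawless Gamma
      & forall k : nat, 2 <= k -> preceq f (lawlessness_growth S k)].
Proof.
have [m [a resF]] := free_group2_quotients.
pose H n : groupType := 'S_(m n).
(* The factor 2 makes E unbounded. *)
pose E N := \prod_(n < N) (2 * #|'S_(m n)|).
have E_gt0 N : 0 < E N.
  by apply: prodn_gt0 => n; rewrite muln_gt0; apply/card_gt0P; exists 1%g.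
have EM N : E N.+1 = E N * (2 * #|'S_(m N)|) by rewrite /E big_ord_recr.
have leE M N : M <= N -> E M <= E N.
  move/subnK <-; elim: (N - M) => // d; rewrite addSn EM => /leq_trans; apply.
  by rewrite leq_pmulr // muln_gt0; apply/card_gt0P; exists 1%g.
have ltE N : N < E N.
  elim: N => [|N IHN]; rewrite ?E_gt0 // EM.
  have : 0 < #|'S_(m N)| by apply/card_gt0P; exists 1%g.
  by nia.
have expE N n (y : H n) : n < N -> (y ^+ E N)%g = 1%g.
  move=> lt_n; have /dvdnP[q ->] : #|'S_(m n)| %| E N.
    by rewrite /E (bigD1 (Ordinal lt_n)) //= dvdn_mulr // dvdn_mull.
  rewrite mulnC expgM -cardsT.
  by rewrite (expg_cardG (finset.in_setT (y : 'S_(m n)))) expg1n.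
(* 128 = 2 * 16 * 4: w has 16 * E N letters, whose values are confined to
   radius 4 R for elements of total length R, and [confined a p r] determines
   lamp n only if 2 r < p n. *)
pose p n := 128 * E n * f (E n.+1) + n.
pose T := @walk_toggles H a p.
exists (generated_groupType T), (@generators _ T).
have lawless2 := @lamplighter_subgroup_lawless H a p resF.
split.
- apply: finite_generators; rewrite /T /walk_toggles !finite_setU.
  by split; [split|]; apply: finite_set1.
- exact: generates_generated.
- apply: ea_lamplighter_subgroup => n; last exact: leq_addl.
  by apply: EA_finite; apply: finite_finset.
- by exists 2.
(* The word used has length [16 * E N] with [E N <= l], hence at most [16 * l]. *)
move=> k k2; exists 16 => // l l_gt0.
have [N /andP[leEl ltEl]] : exists N, E N <= l < E N.+1.
  have exN : exists N, E N <= l by exists 0; rewrite /E big_ord0.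
  have ubN N : E N <= l -> N <= l.
    by move=> le_l; rewrite ltnW // (leq_trans (ltE N)).
  case: (ex_maxnP exN ubN) => N leN maxN; exists N; rewrite leN ltnNge.
  by apply/negP=> /maxN; rewrite ltnn.
have k_gt0 : 0 < k by apply: ltn_trans k2.
pose i : 'I_k := Ordinal k_gt0; pose j : 'I_k := Ordinal k2.
have ij : i != j by [].
have [w [w1 wl wE]] := commutator_power_word ij (E_gt0 N).
apply: (@leq_trans (lawlessness_complexity (@generators _ T) w)); last first.
  apply: leq_trans (leq_pmull _ _) => //.
  by apply: leq_lawlessness_growth; rewrite ?wl ?leq_mul2l.
rewrite /lawlessness_complexity; set A := (X in nat_min X).
(* The minimum is not the default 0: [w] involves only the letters [i] and [j], so a pair violating
   the same word in rank 2 violates [w]. *)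
have [|[g gw1 <-] _] := @nat_minP A.
  have [v [v1 vl vE]] :=
    commutator_power_word (isT : ord0 != ord_max :> 'I_2) (E_gt0 N).
  have [h hv] : exists h : 'I_2 -> generated_groupType T, eval h v <> 1%g.
    by apply/existsNP=> lawv; apply: (lawless2 v).
  pose g l' := if l' == i then h ord0 else h ord_max.
  exists (\sum_(l' < k) word_length (@generators _ T) (g l')), g => //=.
  by rewrite wE /g eqxx (negPf (_ : j != i)) // -vE.
(* A tuple of total length below [f l <= f (E N.+1)] would be short compared with [p n] for all
   [n >= N], and [w] would vanish on it. *)
rewrite leqNgt; apply/negP=> lt_f; apply: gw1.
apply: (short_eval_trivial (N := N) wl wE) => [n y lt_n|n le_n]; first exact: expE.
rewrite /p (@leq_trans (128 * E N * f (E N.+1))) //.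
  by rewrite ltn_mul2l muln_gt0 E_gt0 (leq_trans lt_f) ?f_nondecreasing // ltnW.
apply: leq_trans (leq_addr _ _); rewrite leq_mul ?leq_mul2l ?leE //.
by rewrite f_nondecreasing ?leE.
Qed.
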